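(* A graph $G=(V,E)$ obtained by vertex-pasting from partial cubes $G_1=(V_1,E_1)$ and $G_2=(V_2,E_2)$ is a partial cube.
   Context: Graphs are simple, undirected, nonempty, and not necessarily finite. For a set $X$, the hypercube $\mathcal H(X)$ is the graph whose vertices are the finite subsets of $X$, with $P,Q$ adjacent iff $|P\Delta Q|=1$. A graph is a partial cube if it can be isometrically embedded (i.e. by a map preserving shortest-path distances) into some $\mathcal H(X)$. Vertex-pasting: given connected graphs $G_1,G_2$ and vertices $a_1\in V_1$, $a_2\in V_2$, the graph obtained from $G_1$ and $G_2$ by vertex-pasting (along $a_1,a_2$) is the graph obtained from the disjoint union of $G_1$ and $G_2$ by identifying $a_1$ with $a_2$ (and making no other identifications). *)

(* Defs.v *)
From mathcomp Require Import all_boot generic_quotient finmap boolp.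

Set Implicit Arguments.
Unset Strict Implicit.
Unset Printing Implicit Defensive.

(* The vertex type is an arbitrary type, so graphs may be infinite.  Adjacency
   is a boolean relation, which classically loses no generality. *)
Record graph := Graph {
  vertex :> Type;
  adj : rel vertex;
  adj_sym : symmetric adj;
  adj_irr : irreflexive adj;
  graph_nonempty : inhabited vertex
}.

Arguments adj {g} _ _.

Section Distance.
Variable G : graph.
Implicit Types x y : G.

Definition has_walk x y (n : nat) : bool :=
  `[< exists p : seq G, [/\ path adj x p, last x p = y & size p = n] >].

(* None stands for an infinite distance. *)
Definition dist x y : option nat :=
  if pselect (exists n, has_walk x y n) is left walk_xy
  then Some (ex_minn walk_xy) else None.

End Distance.

Definition isometric_embedding (G H : graph) (f : G -> H) : Prop :=
  forall x y : G, dist (f x) (f y) = dist x y.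

Definition graph_iso (G H : graph) : Prop :=
  exists2 f : G -> H, bijective f & {mono f : x y / adj x y}.

Section Hypercube.
Local Open Scope fset_scope.
Variable X : Type.
Implicit Types P Q : {fset {classic X}}.

Definition hypercube_adj P Q : bool := #|` (P `\` Q) `|` (Q `\` P)| == 1%N.

Lemma hypercube_adj_sym : symmetric hypercube_adj.
Proof. by move=> P Q; rewrite /hypercube_adj fsetUC. Qed.

Lemma hypercube_adj_irr : irreflexive hypercube_adj.
Proof. by move=> P; rewrite /hypercube_adj fsetDv fsetUid cardfs0. Qed.

Definition hypercube : graph :=
  Graph hypercube_adj_sym hypercube_adj_irr (inhabits fset0).

End Hypercube.

Definition partial_cube (G : graph) : Prop :=
  exists (X : Type) (f : G -> hypercube X), isometric_embedding f.

(* Vertex-pasting is usually defined for connected graphs.  The construction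
   does not need this, and partial cubes are connected: two finite subsets are
   always at finite distance in a hypercube, hence so are two vertices of an
   isometrically embedded graph. *)
Section VertexPasting.
Variables (G1 G2 : graph) (a1 : G1) (a2 : G2).

Definition disjoint_union_vertex : choiceType := {classic (G1 + G2)%type}.
Implicit Types x y : disjoint_union_vertex.

Definition disjoint_union_adj x y : bool :=
  match x, y with
  | inl u, inl v => adj u v
  | inr u, inr v => adj u v
  | _, _ => false
  end.

Definition glued x : bool := (x == inl a1) || (x == inr a2).

Definition identified x y : bool := (x == y) || (glued x && glued y).

Lemma identified_refl : reflexive identified.
Proof. by move=> x; rewrite /identified eqxx. Qed.

Lemma identified_sym : symmetric identified.
Proof. by move=> x y; rewrite /identified eq_sym andbC. Qed.

Lemma identified_trans : transitive identified.
Proof.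
move=> y x z /orP[/eqP -> //|/andP[gx gy]] /orP[/eqP <-|/andP[_ gz]].
  by rewrite /identified gx gy orbT.
by rewrite /identified gx gz orbT.
Qed.

Canonical identified_equiv :=
  EquivRel identified identified_refl identified_sym identified_trans.

Definition pasting_vertex : Type := {eq_quot identified_equiv}%qT.

Definition class_of (x : disjoint_union_vertex) : pasting_vertex :=
  (\pi_{eq_quot identified_equiv} x)%qT.

Definition pasting_adj (u v : pasting_vertex) : bool :=
  `[< exists x y, [/\ class_of x = u, class_of y = v & disjoint_union_adj x y] >].

Lemma disjoint_union_adj_sym : symmetric disjoint_union_adj.
Proof. by move=> [u|u] [v|v] //=; rewrite adj_sym. Qed.

Lemma identified_nonadj x y : identified x y -> disjoint_union_adj x y = false.
Proof.
case/orP=> [/eqP <-|]; first by case: x => u /=; rewrite adj_irr.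
by case/andP=> /orP[] /eqP -> /orP[] /eqP -> //=; rewrite adj_irr.
Qed.

Lemma pasting_adj_sym : symmetric pasting_adj.
Proof.
move=> u v; apply/asboolP/asboolP=> -[x [y [xu yv xy]]];
  by exists y, x; rewrite disjoint_union_adj_sym.
Qed.

Lemma pasting_adj_irr : irreflexive pasting_adj.
Proof.
move=> u; apply/asboolP=> -[x [y [xu yu xy]]].
have /eqmodP /identified_nonadj : class_of x = class_of y by rewrite xu yu.
by rewrite xy.
Qed.

Definition vertex_pasting : graph :=
  Graph pasting_adj_sym pasting_adj_irr (inhabits (class_of (inl a1))).

End VertexPasting.

(* Graphs are considered up to isomorphism, so that the type of vertices of the
   pasted graph is not tied to the quotient type above. *)
Definition obtained_by_vertex_pasting (G G1 G2 : graph) : Prop :=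
  exists (a1 : G1) (a2 : G2), graph_iso G (vertex_pasting a1 a2).

(* Main.v *)
Require Import Defs.
From mathcomp Require Import all_boot generic_quotient finmap boolp.

Set Implicit Arguments.
Unset Strict Implicit.
Unset Printing Implicit Defensive.

(** A map [f] from a graph to a hypercube is an isometric embedding iff it
    preserves adjacency and any two vertices [x], [y] are joined by a walk of
    length [|f x Δ f y|].  Given such maps [f1] and [f2], send [u] in [G1] to
    the disjoint sum of [f1 u] and [f2 a2], and [v] in [G2] to the disjoint sum
    of [f1 a1] and [f2 v].  These agree at the pasted vertex, and a walk between
    vertices of different parts is obtained by going through that vertex. *)

(** * Walks and distance *)

Section Walks.
Variable G : graph.
Implicit Types x y z : G.

Lemma has_walk0 x : has_walk x x 0.
Proof. by apply/asboolP; exists [::]. Qed.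

Lemma has_walk0_eq x y : has_walk x y 0 -> x = y.
Proof. by move=> /asboolP[p [_ <- /size0nil ->]]. Qed.

Lemma has_walk_cons x y z n : adj x y -> has_walk y z n -> has_walk x z n.+1.
Proof.
by move=> xy /asboolP[p [yp yz <-]]; apply/asboolP; exists (y :: p); rewrite /= xy.
Qed.

Lemma has_walkS x z n :
  has_walk x z n.+1 -> exists2 y, adj x y & has_walk y z n.
Proof.
move=> /asboolP[[|y p] [//= /andP[xy yp] yz [pn]]].
by exists y => //; apply/asboolP; exists p.
Qed.

Lemma has_walk1 x y : has_walk x y 1 = adj x y.
Proof.
apply/idP/idP => [/has_walkS[z xz /has_walk0_eq <-] //|xy].
exact: has_walk_cons xy (has_walk0 y).
Qed.

Lemma has_walk_cat x y z m n :
  has_walk x y m -> has_walk y z n -> has_walk x z (m + n).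
Proof.
elim: m x => [|m IHm] x; first by move/has_walk0_eq->.
by move=> /has_walkS[t xt ty] yz; apply: has_walk_cons xt (IHm t ty yz).
Qed.

(** Lets later proofs replace the option-valued distance by a walk of length [n] together with a
    lower bound on all walks. *)
Lemma dist_SomeP x y n :
  dist x y = Some n <-> has_walk x y n /\ forall m, has_walk x y m -> n <= m.
Proof.
rewrite /dist; case: pselect => [ex|nex]; last first.
  by split=> // -[xy _]; case: nex; exists n.
case: ex_minnP => k xy kmin; split=> [[<-] //|[xyn nmin]].
by congr Some; apply/eqP; rewrite eqn_leq kmin // nmin.
Qed.

End Walks.

Lemma has_walk_homo (G H : graph) (h : G -> H) x y n :
  {homo h : u v / adj u v} -> has_walk x y n -> has_walk (h x) (h y) n.
Proof.
move=> hh; elim: n x => [|n IHn] x; first by move/has_walk0_eq->; apply: has_walk0.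
by move=> /has_walkS[z xz zy]; apply: has_walk_cons (hh _ _ xz) (IHn z zy).
Qed.

(** * Symmetric differences of finite sets *)

Section SymmetricDifference.
Local Open Scope fset_scope.
Variable K : choiceType.
Implicit Types P Q R : {fset K}.

Definition symdiff P Q := (P `\` Q) `|` (Q `\` P).

Lemma in_symdiff P Q x : (x \in symdiff P Q) = (x \in P) (+) (x \in Q).
Proof. by rewrite !inE; case: (x \in P); case: (x \in Q). Qed.

Lemma symdiff_eq0 P Q : symdiff P Q = fset0 -> P = Q.
Proof.
move=> PQ; apply/fsetP => x; have := in_symdiff P Q x.
by rewrite PQ in_fset0; case: (x \in P); case: (x \in Q).
Qed.

Lemma symdiffPP P : symdiff P P = fset0.
Proof. by rewrite /symdiff fsetDv fsetUid. Qed.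

(** An element separating [P] from [R] separates [P] from [Q] or [Q] from [R], and a union has at
    most as many elements as its two sets together. *)
Lemma card_symdiff_triangle P Q R :
  #|` symdiff P R| <= #|` symdiff P Q| + #|` symdiff Q R|.
Proof.
apply: leq_trans (leq_trans (leq_addr _ _) (eq_leq (cardfsUI _ _))).
apply/fsubset_leq_card/fsubsetP => x; rewrite in_fsetU !in_symdiff.
by case: (x \in P); case: (x \in Q); case: (x \in R).
Qed.

End SymmetricDifference.

(** * Distances in the hypercube *)

Section Hypercube.
Local Open Scope fset_scope.
Variable X : Type.
Implicit Types P Q : hypercube X.

Lemma hypercube_adjE P Q : adj P Q = (#|` symdiff P Q| == 1%N).
Proof. by []. Qed.

Lemma hypercube_walk_geq P Q n : has_walk P Q n -> #|` symdiff P Q| <= n.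
Proof.
elim: n P => [|n IHn] P; first by move/has_walk0_eq->; rewrite symdiffPP cardfs0.
move=> /has_walkS[R]; rewrite hypercube_adjE => /eqP PR /IHn RQ.
by apply: leq_trans (card_symdiff_triangle P R Q) _; rewrite PR add1n.
Qed.

(** Move from [P] to [Q] by correcting one differing element at a time, by induction on a strict
    bound for the number of such elements. *)
Lemma hypercube_walk P Q : has_walk P Q #|` symdiff P Q|.
Proof.
have [n] := ubnP #|` symdiff P Q|; elim: n P => // n IHn P.
have [/symdiff_eq0 ->|[x xPQ]] := fset_0Vmem (symdiff P Q).
  by rewrite symdiffPP cardfs0 => _; apply: has_walk0.
(* Toggling [x] covers both cases at once: it is removed if it lies in [P] and added if it lies in
   [Q]. *)
pose R : hypercube X := symdiff P [fset x].
have PR : symdiff P R = [fset x].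
  by apply/fsetP => y; rewrite !in_symdiff addbA addbb.
have RQ : symdiff R Q = symdiff P Q `\ x.
  apply/fsetP => y; rewrite in_fsetD1 !in_symdiff inE.
  move: xPQ; rewrite in_symdiff; case: eqVneq => [->|_ _] /=.
    by case: (x \in P); case: (x \in Q).
  by rewrite addbF.
have := cardfsD1 x (symdiff P Q); rewrite xPQ add1n -RQ => ->; rewrite ltnS => ltn.
apply: has_walk_cons (IHn R ltn).
by rewrite hypercube_adjE PR cardfs1.
Qed.

Lemma hypercube_dist P Q : dist P Q = Some #|` symdiff P Q|.
Proof.
apply/dist_SomeP; split; first exact: hypercube_walk.
exact: hypercube_walk_geq.
Qed.

(** From right to left, only minimality needs an argument: a walk in [G] maps to a walk of the same
    length in the hypercube, which has at least |f x Δ f y| steps. *)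
Lemma isometric_embeddingP (G : graph) (f : G -> hypercube X) :
  isometric_embedding f <->
  {homo f : x y / adj x y} /\
  forall x y, has_walk x y #|` symdiff (f x) (f y)|.
Proof.
split=> [isof|[homof walkf] x y]; last first.
  rewrite hypercube_dist; apply/esym/dist_SomeP; split=> // m /(has_walk_homo homof).
  exact: hypercube_walk_geq.
have walkf x y := (dist_SomeP x y _).1 (etrans (esym (isof x y)) (hypercube_dist _ _)).
split=> [x y xy|x y]; last exact: (walkf x y).1.
have [fxy minf] := walkf x y; rewrite hypercube_adjE.
have := minf 1%N; rewrite has_walk1 => /(_ xy).
(* The edge bounds the size by 1, and size 0 would make the adjacent [x] and [y] equal. *)
case: #|` _| fxy => [/has_walk0_eq exy _|[|//] //].
by move: xy; rewrite exy adj_irr.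
Qed.

End Hypercube.

(** * Disjoint sums of finite sets *)

Section DisjointSum.
Local Open Scope fset_scope.
Variables X1 X2 : Type.
Local Notation Y1 := {classic X1}.
Local Notation Y2 := {classic X2}.
Local Notation Y := {classic (X1 + X2)%type}.

Definition sum_inl (x : Y1) : Y := inl x.
Definition sum_inr (x : Y2) : Y := inr x.

Definition fset_sum (P : {fset Y1}) (Q : {fset Y2}) : {fset Y} :=
  [fset sum_inl x | x in P] `|` [fset sum_inr x | x in Q].

Lemma sum_inl_inj : injective sum_inl. Proof. by move=> x y []. Qed.
Lemma sum_inr_inj : injective sum_inr. Proof. by move=> x y []. Qed.

Lemma in_fset_sum P Q (z : Y) :
  (z \in fset_sum P Q) = match z with inl x => (x : Y1) \in P
                                    | inr y => (y : Y2) \in Q end.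
Proof.
case: z => [x|y]; rewrite in_fsetU.
  by rewrite orbC (mem_imfset _ _ sum_inl_inj) /=; case: imfsetP => // -[].
by rewrite (mem_imfset _ _ sum_inr_inj) /=; case: imfsetP => // -[].
Qed.

Lemma card_fset_sum P Q : #|` fset_sum P Q| = (#|` P| + #|` Q|)%N.
Proof.
rewrite cardfsU (card_imfset _ _ sum_inl_inj) (card_imfset _ _ sum_inr_inj).
rewrite (_ : _ `&` _ = fset0) ?cardfs0 ?subn0 //.
apply/fsetP => z; rewrite !inE; apply/negP => /andP[].
by move=> /imfsetP[x _ ->] /imfsetP[].
Qed.

Lemma symdiff_fset_sum P Q P' Q' :
  symdiff (fset_sum P Q) (fset_sum P' Q') =
  fset_sum (symdiff P P') (symdiff Q Q').
Proof.
by apply/fsetP => -[x|y]; rewrite !(in_symdiff, in_fset_sum).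
Qed.

End DisjointSum.

(** * The embedding of the pasted graph *)

Section Pasting.
Local Open Scope fset_scope.
Variables (G1 G2 : graph) (a1 : G1) (a2 : G2).
Local Notation G := (vertex_pasting a1 a2).

Definition paste_inl (u : G1) : G := class_of a1 a2 (inl u).
Definition paste_inr (v : G2) : G := class_of a1 a2 (inr v).

Lemma paste_inl_homo : {homo paste_inl : x y / adj x y}.
Proof. by move=> x y xy; apply/asboolP; exists (inl x), (inl y). Qed.

Lemma paste_inr_homo : {homo paste_inr : x y / adj x y}.
Proof. by move=> x y xy; apply/asboolP; exists (inr x), (inr y). Qed.

Lemma paste_glue : paste_inl a1 = paste_inr a2.
Proof. by apply/eqmodP; rewrite /= /identified /glued !eqxx !orbT. Qed.

Lemma paste_inl_or_inr (u : G) :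
  (exists x, u = paste_inl x) \/ (exists y, u = paste_inr y).
Proof.
have : u = class_of a1 a2 (repr (u : {eq_quot identified_equiv a1 a2})%qT).
  by rewrite /class_of reprK.
by case: (repr _) => [x|y] ->; [left; exists x | right; exists y].
Qed.

Variables (X1 X2 : Type) (f1 : G1 -> hypercube X1) (f2 : G2 -> hypercube X2).

Definition sum_embedding (z : disjoint_union_vertex G1 G2) :
    hypercube (X1 + X2) :=
  match z with
  | inl u => fset_sum (f1 u) (f2 a2)
  | inr v => fset_sum (f1 a1) (f2 v)
  end.

Definition paste_embedding (u : G) : hypercube (X1 + X2) :=
  sum_embedding (repr (u : {eq_quot identified_equiv a1 a2})%qT).

(** The choice made by [repr] is harmless: distinct identified points are both glued, and each of
    them is sent to [fset_sum (f1 a1) (f2 a2)]. *)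
Lemma paste_embedding_class z : paste_embedding (class_of a1 a2 z) = sum_embedding z.
Proof.
rewrite /paste_embedding /class_of; set y := repr _.
have /eqmodP : (\pi_{eq_quot identified_equiv a1 a2} y =
                \pi_{eq_quot identified_equiv a1 a2} z)%qT by rewrite reprK.
case/orP=> [/eqP -> //|/andP[]].
by case/orP=> /eqP -> /orP[] /eqP ->.
Qed.

Lemma paste_embedding_isometric :
  isometric_embedding f1 -> isometric_embedding f2 ->
  isometric_embedding paste_embedding.
Proof.
move=> /isometric_embeddingP[homo1 walk1] /isometric_embeddingP[homo2 walk2].
apply/isometric_embeddingP; split=> [u v /asboolP[x [y [<- <-]]]|u v].
  rewrite !paste_embedding_class hypercube_adjE.
  (* An edge lies within one part, so the other coordinate is constant and contributes nothing to
     the symmetric difference. *)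
  by case: x y => [x|x] [y|y] //= xy;
    rewrite symdiff_fset_sum card_fset_sum symdiffPP cardfs0 ?addn0 ?add0n;
    [exact: homo1 | exact: homo2].
have [[x ->]|[x ->]] := paste_inl_or_inr u; have [[y ->]|[y ->]] := paste_inl_or_inr v;
  rewrite !paste_embedding_class /= symdiff_fset_sum card_fset_sum
    ?symdiffPP ?cardfs0 ?addn0 ?add0n.
- exact: has_walk_homo paste_inl_homo (walk1 x y).
- apply: (@has_walk_cat _ _ (paste_inl a1)).
    exact: has_walk_homo paste_inl_homo (walk1 x a1).
  by rewrite paste_glue; apply: has_walk_homo paste_inr_homo (walk2 a2 y).
(* The walk now starts in [G2], whereas the cardinality lists the contribution of [G1] first. *)
- rewrite addnC; apply: (@has_walk_cat _ _ (paste_inr a2)).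
    exact: has_walk_homo paste_inr_homo (walk2 x a2).
  by rewrite -paste_glue; apply: has_walk_homo paste_inl_homo (walk1 a1 y).
- exact: has_walk_homo paste_inr_homo (walk2 x y).
Qed.

End Pasting.

(** Compose the embedding of [H] with the isomorphism; its inverse also preserves adjacency, so the
    required walks pull back from [H] to [G]. *)
Lemma partial_cube_iso (G H : graph) :
  graph_iso G H -> partial_cube H -> partial_cube G.
Proof.
move=> [h [g hK gK] hmono] [X [f /isometric_embeddingP[homof walkf]]].
exists X, (f \o h); apply/isometric_embeddingP; split=> [x y xy|x y] /=.
  by apply: homof; rewrite hmono.
have homog : {homo g : u v / adj u v} by move=> u v uv; rewrite -hmono !gK.
by have := has_walk_homo homog (walkf (h x) (h y)); rewrite !hK.
Qed.

Theorem theorem7p1 (G G1 G2 : graph)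
  (pc1 : partial_cube G1) (pc2 : partial_cube G2)
  (pasted : obtained_by_vertex_pasting G G1 G2) :
  partial_cube G.
Proof.
case: pc1 pc2 pasted => [X1 [f1 iso1]] [X2 [f2 iso2]] [a1 [a2 isoG]].
apply: partial_cube_iso isoG _.
exists (X1 + X2)%type, (paste_embedding f1 f2).
exact: paste_embedding_isometric.
Qed.
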